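(* Let $G$ be a locally finite weakly connected digraph, let $r \in V(G)$ and let $k \in \mathbb{N}$. Then $G$ has $k$ edge-disjoint spanning pseudo-arborescences rooted in $r$ if and only if for every bipartition $(X,Y)$ of $V(G)$ with $r \in X$ and only finitely many edges between $X$ and $Y$ (counting edges in either direction) there are at least $k$ edges of $G$ directed from $X$ to $Y$.
   Context: Digraphs may be infinite and may have parallel edges but no loops. A digraph is weakly connected if its underlying undirected multigraph is connected, and locally finite if every vertex has finite in- and out-degree. The two classes of a bipartition are non-empty. An edge is directed from $X$ to $Y$ if its tail is in $X$ and its head is in $Y$. For a locally finite weakly connected digraph $G$ and $r\in V(G)$, a spanning pseudo-arborescence rooted in $r$ is an inclusion-wise minimal edge set $F \subseteq E(G)$ among those edge sets $F$ with the following property: for every bipartition $(X,Y)$ of $V(G)$ with $r \in X$ and only finitely many edges of $G$ between $X$ and $Y$ (in either direction), $F$ contains an edge directed from $X$ to $Y$. *)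

(* Defs.v *)
From Stdlib Require Import Relation_Operators.
From mathcomp Require Import all_boot.
From mathcomp Require Import boolp classical_sets functions cardinality.

Set Implicit Arguments.
Unset Strict Implicit.
Unset Printing Implicit Defensive.

Local Open Scope classical_set_scope.

(* Edges form a type of their own, so distinct edges may have the same tail and
   head. *)
Record digraph := Digraph {
  vertex : Type;
  edge : Type;
  tail : edge -> vertex;
  head : edge -> vertex;
  loopless : forall e : edge, tail e <> head e
}.

Section Digraph.
Variable G : digraph.
Implicit Types (X Y : set (vertex G)) (F : set (edge G)).

Definition adjacent (u v : vertex G) : Prop :=
  exists e : edge G,
    (tail e = u /\ head e = v) \/ (tail e = v /\ head e = u).

Definition weakly_connected : Prop :=
  forall u v : vertex G, clos_refl_trans (vertex G) adjacent u v.

Definition locally_finite : Prop :=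
  forall v : vertex G,
    finite_set [set e : edge G | tail e = v] /\
    finite_set [set e : edge G | head e = v].

Definition bipartition X Y : Prop :=
  [/\ X !=set0, Y !=set0, X `|` Y = setT & X `&` Y = set0].

Definition edges_from_to X Y : set (edge G) :=
  [set e | X (tail e) /\ Y (head e)].

Definition edges_between X Y : set (edge G) :=
  edges_from_to X Y `|` edges_from_to Y X.

Definition meets_finite_cuts (r : vertex G) F : Prop :=
  forall X Y, bipartition X Y -> X r -> finite_set (edges_between X Y) ->
    F `&` edges_from_to X Y !=set0.

Definition spanning_pseudo_arborescence (r : vertex G) F : Prop :=
  meets_finite_cuts r F /\
  forall F', F' `<=` F -> meets_finite_cuts r F' -> F' = F.

End Digraph.

Arguments weakly_connected : clear implicits.
Arguments locally_finite : clear implicits.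

(* Main.v *)
(* Both conditions only concern finite cuts, so the nontrivial direction is a
   compactness argument: colour the edges with [k] colours so that every finite
   cut contains, directed away from [r], an edge of each colour.  Finitely many
   finite cuts split the vertices into finitely many atoms; contracting these
   leaves a finite digraph, where Edmonds' branching theorem (in Lovász's proof)
   provides the colours, and a limit along an ultrafilter then handles all finite
   cuts at once.  Each colour class shrinks to a minimal edge set by Zorn's lemma,
   again because the cuts involved are finite. *)
Require Import Defs.
From mathcomp Require Import all_boot.

Set Implicit Arguments.
Unset Strict Implicit.
Unset Printing Implicit Defensive.

(** * Edmonds' theorem on disjoint branchings in finite digraphs *)

Section Edmonds.
Variables (T E : finType) (tl hd : E -> T) (r : T).
Implicit Types (A B : {set E}) (S Z : {set T}) (e : E) (k : nat).

Definition enters e Z := (tl e \notin Z) && (hd e \in Z).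

Definition indegree A Z := #|[set e in A | enters e Z]|.

(** For [k = 1] this says that [A] reaches every vertex from [r]; such edge sets stand in for
    spanning branchings, without recording a tree structure. *)
Definition rooted_connected k A :=
  forall Z, Z != set0 -> r \notin Z -> k <= indegree A Z.

Lemma indegreeE A Z : indegree A Z = \sum_(e in A) enters e Z.
Proof.
rewrite /indegree -sum1_card (eq_bigl (fun e => (e \in A) && enters e Z)).
  by rewrite big_mkcondr; apply: eq_bigr => e _; case: (enters e Z).
by move=> e; rewrite inE.
Qed.

Lemma indegree_submodular A Z1 Z2 :
  indegree A (Z1 :&: Z2) + indegree A (Z1 :|: Z2)
    <= indegree A Z1 + indegree A Z2.
Proof.
rewrite !indegreeE -!big_split; apply: leq_sum => e _ /=.
rewrite /enters !inE.
by do 2![case: (tl e \in _)]; do 2![case: (hd e \in _)].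
Qed.

Lemma indegreeD1 A e Z :
  e \in A -> indegree A Z = enters e Z + indegree (A :\ e) Z.
Proof. by move=> eA; rewrite !indegreeE (big_setD1 e eA). Qed.

Lemma indegree_gt0P A Z :
  reflect (exists2 e, e \in A & enters e Z) (0 < indegree A Z).
Proof.
apply: (iffP card_gt0P) => [[e]|[e eA eZ]]; last by exists e; rewrite inE eA.
by rewrite inE => /andP[]; exists e.
Qed.

(* Take for [e] an edge leaving [S] inside an inclusion-minimal set of indegree
   [k] not contained in [S], if there is such a set: by submodularity, it enters
   no set of indegree [k]. *)
Lemma safe_edge k A B S :
  rooted_connected k.+1 A -> rooted_connected k (A :\: B) -> r \in S ->
  S != setT -> (forall e, e \in B -> hd e \in S) ->
  exists e, [/\ e \in A :\: B, tl e \in S, hd e \notin S &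
    rooted_connected k (A :\: B :\ e)].
Proof.
move=> kA kD rS ST hdB; set D := A :\: B.
(* Edges of [B] have their heads in [S], so none of them enters [Z :\: S]; if nonempty and without
   [r], this set keeps indegree at least [k.+1] in [D]. *)
have indegD Z : indegree D (Z :\: S) = indegree A (Z :\: S).
  apply: eq_card => e; rewrite !inE /enters !inE.
  by case eB: (e \in B); rewrite //= (hdB _ eB) /= !andbF.
suff [e [eD tle hde safe]] : exists e, [/\ e \in D, tl e \in S, hd e \notin S &
    forall Z, r \notin Z -> enters e Z -> indegree D Z != k].
  exists e; split=> // Z Z0 rZ; have := kD Z Z0 rZ; rewrite -/D.
  have := safe Z rZ; rewrite (indegreeD1 _ eD) eq_sym; case: (enters e Z) => //=.
  by move=> /(_ isT) neq; rewrite leq_eqVlt (negPf neq).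
pose tight Z := [&& r \notin Z, ~~ (Z \subset S) & indegree D Z == k].
case: (boolP [exists Z, tight Z]) => [/existsP/ex_minset[Z minZ]|no_tight]; last first.
  have /indegree_gt0P[e eD] : 0 < indegree D (setT :\: S).
    rewrite indegD; apply: leq_trans (kA _ _ _); rewrite // ?inE ?rS //.
    by rewrite setTD; apply: contraNneq ST => SC; rewrite -[S]setCK SC setC0.
  rewrite /enters !inE !andbT negbK => /andP[tle hde].
  exists e; split=> // Z rZ /andP[_ heZ]; apply/negP => Zk.
  case/existsP: no_tight; exists Z; rewrite /tight rZ Zk andbT; apply/subsetPn.
  by exists (hd e).
have /and3P[rZ ZS /eqP Zk] := minsetp minZ.
(* [Z :\: S] has indegree above [k] in [D] and [Z] has exactly [k], so some edge enters the former
   from inside [Z], hence from [Z :&: S]. *)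
have [e eD /andP[eZS eZ]] : exists2 e, e \in D & enters e (Z :\: S) && ~~ enters e Z.
  apply/exists_inP; apply: contraT; rewrite negb_exists_in => /forall_inP noe.
  suff: k < k by rewrite ltnn.
  rewrite -{2}Zk; apply: (@leq_trans (indegree D (Z :\: S))).
    rewrite indegD; apply: kA; rewrite ?inE ?(negPf rZ) ?andbF //.
    by rewrite setD_eq0.
  apply: subset_leq_card; apply/subsetP => e; rewrite !inE => /andP[eD eZS].
  by move: (noe e); rewrite inE eD eZS /= negbK => /(_ isT).
move: eZS eZ; rewrite /enters !inE => /andP[tle /andP[hde heZ]].
rewrite heZ andbT negbK => teZ; exists e; split=> //.
  by move: tle; rewrite teZ andbT negbK.
move=> Z' rZ' /andP[teZ' heZ']; apply/eqP => Z'k.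
have heI : hd e \in Z :&: Z' by rewrite inE heZ.
have leI : k <= indegree D (Z :&: Z').
  by apply: kD; [apply/set0Pn; exists (hd e) | rewrite inE negb_and rZ].
have leU : k <= indegree D (Z :|: Z').
  apply: kD; last by rewrite inE negb_or rZ.
  by apply/set0Pn; exists (hd e); rewrite inE heZ.
(* Intersection and union have indegree at least [k] each and at most [k + k] together. Once the
   intersection is tight, minimality of [Z] forces [tl e] into [Z'], a contradiction. *)
have tightI : tight (Z :&: Z').
  rewrite /tight inE negb_and rZ /=; apply/andP; split.
    by apply/subsetPn; exists (hd e).
  rewrite eqn_leq leI andbT; have := indegree_submodular D Z Z'.
  by rewrite Zk Z'k => /(leq_trans (leq_add (leqnn _) leU)); rewrite leq_add2r.
have /setP/(_ (tl e)) := minsetinf minZ tightI (subsetIl _ _).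
by rewrite inE teZ (negPf teZ').
Qed.

Lemma extract_branching k A : rooted_connected k.+1 A ->
  exists2 B : {set E}, B \subset A &
    rooted_connected 1 B /\ rooted_connected k (A :\: B).
Proof.
move=> kA.
(* [B] grows as an arborescence from [r] with vertex set [S], one safe edge at a time; only its cut
   property is kept. At [m = #|T|] the set [S] must be everything. *)
suff grow m : exists (B : {set E}) (S : {set T}),
  [/\ B \subset A, rooted_connected k (A :\: B),
    (forall e, e \in B -> hd e \in S),
    r \in S /\ (S == setT) || (m < #|S|) &
    forall Z, r \notin Z -> ~~ [disjoint S & Z] -> 0 < indegree B Z].
  have [B [S [BA kAB _ [_ Slarge] BS]]] := grow #|T|.
  exists B => //; split=> // Z Z0 rZ; apply: BS => //.
  case/orP: Slarge => [/eqP ->|]; last by rewrite ltnNge max_card.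
  by rewrite -setI_eq0 setTI.
elim: m => [|m [B [S [BA kAB hdB [rS Slarge] BS]]]].
  exists set0, [set r]; split; rewrite ?sub0set // ?setD0.
  - by move=> Z Z0 rZ; apply: ltnW; apply: kA.
  - by move=> e; rewrite in_set0.
  - by split; rewrite ?set11 // cards1 orbT.
  - by move=> Z rZ; rewrite disjoints1 negbK (negPf rZ).
case: (eqVneq S setT) => [ST|SnT].
  by exists B, S; split=> //; rewrite ST eqxx inE.
have [e [eD tle hde kABe]] := safe_edge kA kAB rS SnT hdB.
have eB : e \notin B by move: eD; rewrite inE => /andP[].
exists (e |: B), (hd e |: S); split.
- by rewrite subUset sub1set BA andbT; move: eD; rewrite inE => /andP[].
- by rewrite setUC -setDDl.
- by move=> f; rewrite !inE => /orP[/eqP -> | /hdB ->]; rewrite ?eqxx ?orbT.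
- split; first by rewrite !inE rS orbT.
  by rewrite cardsU1 hde add1n ltnS -[_ < _]orFb -(negPf SnT) Slarge orbT.
move=> Z rZ; case: (boolP [disjoint S & Z]) => [SZ|/(BS _ rZ) BZ _]; last first.
  by rewrite (indegreeD1 _ (setU11 e B)) setU1K // addn_gt0 BZ orbT.
rewrite -setI_eq0 setIUl setU_eq0 setI_eq0 negb_and => /orP[|]; last first.
  by rewrite setI_eq0 SZ.
rewrite disjoints1 negbK => heZ.
by rewrite (indegreeD1 _ (setU11 e B)) /enters heZ (disjointFr SZ tle).
Qed.

(** Each extracted branching gets its own colour. Leftover edges get colour 0, which is harmless
    since extra edges in a class spoil no cut. *)
Lemma disjoint_branchings k A : rooted_connected k A ->
  exists c : E -> nat, forall i Z, i < k -> Z != set0 -> r \notin Z ->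
    exists e, [/\ e \in A, c e = i & enters e Z].
Proof.
elim: k A => [|k IHk] A kA; first by exists (fun=> 0).
have [B BA [conB /IHk[c cP]]] := extract_branching kA.
exists (fun e => if e \in B then k else c e) => i Z.
rewrite ltnS leq_eqVlt => /orP[/eqP ->|ik] Z0 rZ.
  have /indegree_gt0P[e eB eZ] := conB Z Z0 rZ.
  by exists e; rewrite eB (subsetP BA).
have [e [eAB <- eZ]] := cP i Z ik Z0 rZ; exists e.
by move: eAB; rewrite inE => /andP[/negPf -> ->].
Qed.

End Edmonds.

From mathcomp Require Import finmap.
From mathcomp Require Import boolp classical_sets functions cardinality filter.
(* Restores [tail] and [head], which [seq] shadows. *)
Import Defs.

Local Open Scope classical_set_scope.
Local Open Scope card_scope.

(** * From finite quotients to a colouring for all finite cuts *)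

Lemma bipartition_setC (G : digraph) (X Y : set (vertex G)) :
  bipartition X Y -> Y = ~` X.
Proof.
move=> [_ _ XYT XY0]; apply/seteqP; split=> v.
  by move=> Yv Xv; suff : (X `&` Y) v; [rewrite XY0|split].
by move=> nXv; have : setT v by []; rewrite -XYT => -[].
Qed.

(** The ultrafilter decides each of the finitely many values below [m]. The guard makes values from
    [m] on irrelevant, so [f] may be unbounded. *)
Lemma ultrafilter_limit (I : Type) (U : set_system I) (f : I -> nat) m :
  UltraFilter U -> exists i, U [set x | (f x < m)%N -> f x = i].
Proof.
move=> ultraU; elim: m => [|m [i Ui]].
  by exists 0%N; apply: filterS filterT => x _.
have [Um|Um] := in_ultra_setVsetC [set x | f x = m] ultraU.
  by exists m; apply: filterS Um => x /= ->.
exists i; apply: filterS (filterI Ui Um) => x [/= fi /eqP fm].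
by rewrite ltnS leq_eqVlt (negPf fm).
Qed.

Section InfiniteDigraph.
Variables (G : digraph) (r : vertex G) (k : nat).
Hypothesis cuts_large : forall X Y : set (vertex G),
  bipartition X Y -> X r -> finite_set (edges_between X Y) ->
  `I_k #<= edges_from_to X Y.

(** Contracting the fibres of [q] leaves a finite digraph whose cuts are finite cuts of [G], so
    [cuts_large] supplies the hypothesis of Edmonds' theorem. *)
Lemma quotient_coloring (T : finType) (q : vertex G -> T) :
  (forall t, exists v, q v = t) ->
  finite_set [set e : edge G | q (tail e) != q (head e)] ->
  exists c : edge G -> nat, forall (Z : {set T}) i,
    (i < k)%N -> Z != finset.set0 -> q r \notin Z ->
    exists e, [/\ c e = i, q (tail e) \notin Z & q (head e) \in Z].
Proof.
move=> q_surj finD.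
set D : set {classic edge G} := [set e | q (tail e) != q (head e)] in finD.
pose F := fset_set D.
have memF (e : {classic edge G}) : (e \in F) = (q (tail e) != q (head e)).
  by rewrite /F in_fset_set //; apply/idP/idP; rewrite inE.
pose tl (e : F) := q (tail (val e : edge G)).
pose hd (e : F) := q (head (val e : edge G)).
have kF : rooted_connected tl hd (q r) k [set: F].
  move=> Z Z0 rZ; pose Y := [set v | q v \in Z]; pose X := ~` Y.
  have XY : bipartition X Y.
    split; [by exists r; apply/negP| |by rewrite setUC setUv|by rewrite setIC setICr].
    by have /set0Pn[t tZ] := Z0; have [v qv] := q_surj t; exists v; rewrite /Y /= qv.
  have subD : edges_between X Y `<=` D.
    move=> e eXY; apply/eqP => qe.
    by case: eXY => -[]; rewrite /X /Y /= qe.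
  have finXY := sub_finite_set subD finD.
  have finX : finite_set (edges_from_to X Y : set {classic edge G}).
    by apply: sub_finite_set finXY => e; left.
  have := leq_card_fset_set finX (cuts_large XY (negP rZ) finXY).
  have sub : (fset_set (edges_from_to X Y : set {classic edge G}) `<=` F)%fset.
    apply/fsubsetP => e; rewrite in_fset_set // inE => eXY; rewrite memF.
    by apply: subD; left.
  move=> /leq_trans; apply; rewrite -(card_fsub sub).
  apply: subset_leq_card; apply/fintype.subsetP => e.
  rewrite in_fsub in_fset_set // !inE => -[/negP te he].
  by rewrite /enters te.
have [c cP] := disjoint_branchings kF.
(* Edges inside a fibre get a dummy colour. *)
exists (fun e => if insub (e : {classic edge G}) is Some f then c (f : F) else 0%N).
move=> Z i ik Z0 rZ; have [e [_ ce /andP[te he]]] := cP i Z ik Z0 rZ.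
by exists (val e); rewrite valK.
Qed.

Definition rooted_finite_cut (X : set (vertex G)) :=
  [/\ X r, ~` X !=set0 & finite_set (edges_between X (~` X))].

Definition rainbow (c : edge G -> nat) (X : set (vertex G)) :=
  forall i, (i < k)%N -> exists2 e, edges_from_to X (~` X) e & c e = i.

Lemma finite_family_coloring (s : seq (set (vertex G))) :
  exists c, forall X, X \in s -> rooted_finite_cut X -> rainbow c X.
Proof.
wlog s_cuts : s / forall X, X \in s -> rooted_finite_cut X.
  move=> /(_ [seq X <- s | `[< rooted_finite_cut X >]])[X|c cP].
    by rewrite mem_filter => /andP[/asboolP].
  by exists c => X Xs cutX; apply: cP => //; rewrite mem_filter Xs andbT; apply/asboolP.
pose S i := nth setT s i.
pose atom v : {ffun 'I_(size s) -> bool} := [ffun i : 'I__ => `[< S i v >]].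
(* Only membership patterns that occur are kept, which makes [q] surjective. An edge between
   distinct atoms crosses some cut of [s], so there are finitely many. *)
pose T := {t | `[< exists v, atom v = t >]}.
have atomP v : `[< exists w, atom w = atom v >] by apply/asboolP; exists v.
pose q v : T := exist _ (atom v) (atomP v).
have q_surj t : exists v, q v = t.
  by case: t => t t_atom; have /asboolP[v vt] := t_atom; exists v; apply: val_inj.
have [|c cP] := quotient_coloring q_surj.
  apply: (@sub_finite_set _ _
    (\bigcup_(i in `I_(size s)) edges_between (S i) (~` S i))); last first.
    apply: bigcup_finite => // i /= ilt.
    by have [] := s_cuts (S i) (mem_nth _ ilt).
  move=> e /= qe; apply: contrapT => noS; case/eqP: qe; apply: val_inj => /=.
  apply/ffunP => i; rewrite !ffunE; apply/asboolP/asboolP => Si;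
    apply: contrapT => nSi; apply: noS; exists i => //=; [left|right]; by split.
exists c => X Xs [Xr [w nXw] _] i ik.
have Xidx : (index X s < size s)%N by rewrite index_mem.
pose Z := [set t : T | ~~ val t (Ordinal Xidx)]%SET.
have qZ v : (q v \in Z) = ~~ `[< X v >].
  by rewrite inE ffunE /S /= nth_index.
have [||e [ce te he]] := cP Z i ik.
- by apply/set0Pn; exists (q w); rewrite qZ; apply/asboolPn.
- by rewrite qZ negbK; apply/asboolP.
exists e => //; split.
  by move: te; rewrite qZ negbK => /asboolP.
by move: he; rewrite qZ => /asboolPn.
Qed.

Lemma rainbow_coloring :
  exists c, forall X, rooted_finite_cut X -> rainbow c X.
Proof.
have [cs csP] := choice finite_family_coloring.
(* The sets of lists extending a given list generate a proper filter; for an ultrafilter above it,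
   almost every list contains any given cut. *)
pose base (s : seq (set (vertex G))) := [set t : seq _ | {subset s <= t}].
have Fproper : ProperFilter (filter_from setT base).
  apply: filter_from_proper => [|s _]; last by exists s => X.
  apply: filter_fromT_filter; first by exists [::].
  move=> s t; exists (s ++ t) => u stu.
  by split=> X Xs; apply: stu; rewrite mem_cat Xs ?orbT.
have [U [ultraU FU]] := ultraFilterLemma Fproper.
have /choice[c cP] : forall e, exists i, U [set s | (cs s e < k)%N -> cs s e = i].
  by move=> e; apply: ultrafilter_limit.
exists c => X cutX i ik; have [_ _ finX] := cutX.
have /finite_fsetP[D defD] : finite_set (edges_between X (~` X) : set {classic edge G}) := finX.
(* As the cut is finite, almost every [cs s] agrees with [c] on all its edges at once, up to colours
   from [k] on. *)
have UD : U (\bigcap_(e in [set` D]) [set s | (cs s e < k)%N -> cs s e = c e]).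
  by apply: filter_bigI => e _; apply: cP.
have UX : U [set s | X \in s].
  by apply: FU; exists [:: X] => // s Xs; apply: Xs; exact: mem_head.
have [s [/= Xs sD]] := filter_ex (filterI UX UD).
have [e eX cse] := csP s X Xs cutX i ik.
by exists e => //; rewrite -(sD e) ?cse // -defD; left.
Qed.

End InfiniteDigraph.

(** * Shrinking to a minimal edge set *)

Lemma chain_meets_finite (T : eqType) (C : set (set T)) (s : seq T) :
  C !=set0 -> total_on C subset ->
  (forall F, C F -> exists2 x, x \in s & F x) ->
  exists2 x, x \in s & forall F, C F -> F x.
Proof.
move=> [F1 CF1] totC; elim: s => [/(_ _ CF1)[x]//|a s IHs meet].
have [aC|] := pselect (forall F, C F -> F a); first by exists a; rewrite ?mem_head.
move=> /existsNP[F0 /not_implyP[CF0 nF0a]].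
(* Every [F] in [C] contains a member of [C] that is also below [F0], hence
   avoids [a]. *)
suff /IHs[x xs xC] : forall F, C F -> exists2 x, x \in s & F x.
  by exists x => //; rewrite inE xs orbT.
move=> F CF.
have [H [CH HF HF0]] : exists H, [/\ C H, H `<=` F & H `<=` F0].
  by have [sub|sub] := totC _ _ CF CF0; [exists F | exists F0]; split.
have [x + Hx] := meet H CH; rewrite inE => /orP[/eqP xa|xs].
  by case: nF0a; rewrite -xa; apply: HF0.
by exists x => //; apply: HF.
Qed.

Lemma pseudo_arborescence_sub (G : digraph) (r : vertex G) (F0 : set (edge G)) :
  meets_finite_cuts r F0 ->
  exists2 F, F `<=` F0 & spanning_pseudo_arborescence r F.
Proof.
move=> F0P.
(* Zorn is applied to the removed sets [A], so that a chain is bounded by its union. *)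
have [|A [AP Amax]] := @Zorn_bigcup _ [set A | meets_finite_cuts r (F0 `\` A)].
  move=> C CP totC X Y XY Xr finXY.
  have [->|/set0P[A0 CA0]] := eqVneq C set0.
    by rewrite bigcup_set0 setD0; apply: F0P.
  have /finite_seqP[s defs] : finite_set (edges_between X Y : set {classic edge G}) := finXY.
  (* A single edge of this finite cut survives every removal in the chain. *)
  have [||F|e es eC] := @chain_meets_finite {classic edge G}
    [set (F0 `\` A) `&` edges_from_to X Y | A in C] s.
  - by exists ((F0 `\` A0) `&` edges_from_to X Y); exists A0.
  - move=> _ _ [A CA <-] [B CB <-].
    by have [AB|BA] := totC _ _ CA CB; [right|left]; apply: setSI; apply: setDS.
  - move=> [A CA <-]; have [e eA] := CP A CA X Y XY Xr finXY.
    by exists e => //; suff : [set` s] e by []; rewrite -defs; left; case: eA.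
  have [[F0e _] eXY] := eC _ (ex_intro2 _ _ A0 CA0 erefl).
  exists e; split=> //; split=> // -[A CA Ae].
  by have [[_ ]] := eC _ (ex_intro2 _ _ A CA erefl).
exists (F0 `\` A); first exact: subDsetl.
split=> // F FA FP; apply/seteqP; split=> // e [F0e nAe]; apply: contrapT => nFe.
(* Removing everything outside [F] leaves exactly [F], and [e] makes this removed set strictly
   larger than [A]. *)
apply: (Amax (A `|` ~` F)).
  split; first exact: subsetUl.
  by move=> /(_ e (or_intror nFe)).
rewrite /=; suff -> : F0 `\` (A `|` ~` F) = F by [].
apply/seteqP; split=> x; first by move=> [_ /not_orP[_ /contrapT]].
by move=> Fx; have [F0x nAx] := FA x Fx; split=> // -[].
Qed.

Theorem theorem1p5 (G : digraph) (r : vertex G) (k : nat)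
    (G_locally_finite : locally_finite G)
    (G_weakly_connected : weakly_connected G) :
  (exists T : 'I_k -> set (edge G),
     (forall i : 'I_k, spanning_pseudo_arborescence r (T i)) /\
     (forall i j : 'I_k, i <> j -> T i `&` T j = set0))
  <->
  (forall X Y : set (vertex G),
     bipartition X Y -> X r -> finite_set (edges_between X Y) ->
     `I_k #<= edges_from_to X Y).
Proof.
split=> [[T [spT disjT]] X Y XY Xr finXY|large].
  (* One edge of the cut per arborescence; disjointness makes the choice injective. *)
  have /choice[f fP] : forall i : 'I_k, exists e, (T i `&` edges_from_to X Y) e.
    by move=> i; apply: (proj1 (spT i)).
  have f_inj : injective f.
    move=> i j fij; apply: contrapT => ij.
    suff: (T i `&` T j) (f i) by rewrite disjT.
    by split; [case: (fP i)|rewrite fij; case: (fP j)].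
  rewrite (card_le_eql card_II).
  rewrite -(card_le_eql (inj_card_eq (in2W f_inj))).
  by apply: subset_card_le => _ [i _ <-]; case: (fP i).
have [c cP] := rainbow_coloring large.
have /choice[T TP] : forall i : 'I_k, exists F,
    F `<=` [set e | c e = i] /\ spanning_pseudo_arborescence r F.
  move=> i.
  have [|F] := @pseudo_arborescence_sub G r [set e | c e = i]; last by exists F.
  move=> X Y XY Xr finXY; have defY := bipartition_setC XY.
  have [_ Y0 _ _] := XY; rewrite defY in finXY Y0 *.
  have [e eX ce] := cP X (And3 Xr Y0 finXY) i (ltn_ord i).
  by exists e.
exists T; split=> [i|i j ij]; first by case: (TP i).
apply/seteqP; split=> // e [/(proj1 (TP i)) /= ci /(proj1 (TP j)) /= cj].
by apply: ij; apply: val_inj; exact: etrans (esym ci) cj.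
Qed.
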